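(* Fix an integer $r\geq 4$ and let $k:= \tfrac12 \left( r + \sqrt{r^2-4r} \right)$; note $k\geq r-2$. For every $n\in\mathbb{N}$ and every $r$-list-assignment $L$ of an $n$-vertex path $P$, there are at least $k^n$ nonrepetitive $L$-colourings of $P$.
   Context: A path $P=(v_1,\dots,v_n)$ has edges $v_iv_{i+1}$. Given a colouring $\phi$, a sequence $(u_1,\dots,u_{2t})$ of vertices is repetitively coloured if $\phi(u_i)=\phi(u_{t+i})$ for all $i\in\{1,\dots,t\}$; a colouring of $P$ is nonrepetitive if no subpath $(v_j,v_{j+1},\dots,v_{j+2t-1})$ is repetitively coloured. An $r$-list-assignment $L$ assigns to each vertex $v$ a set $L(v)$ of colours with $|L(v)|\ge r$; an $L$-colouring is a colouring $\phi$ with $\phi(v)\in L(v)$ for all $v$. *)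

(* Defs.v *)
From mathcomp Require Import all_boot all_order all_algebra.
From mathcomp Require Import boolp classical_sets functions cardinality reals.

Set Implicit Arguments.
Unset Strict Implicit.
Unset Printing Implicit Defensive.

Import Order.TTheory GRing.Theory Num.Theory.

Local Open Scope classical_set_scope.
Local Open Scope card_scope.
Local Open Scope ring_scope.

(* The path (v_1, ..., v_n) on the vertex set V is the bijection P : 'I_n -> V,
   with P i = v_(i+1). *)

Definition subpath (V : Type) (n m : nat) (P : 'I_n -> V) (j : nat)
    (h : (j + m <= n)%N) : 'I_m -> V :=
  fun i => P (widen_ord h (rshift j i)).

Definition repetitively_coloured (V C : Type) (phi : V -> C) (t : nat)
    (u : 'I_(t + t) -> V) : Prop :=
  forall i : 'I_t, phi (u (lshift t i)) = phi (u (rshift t i)).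

Definition nonrepetitive (V C : Type) (n : nat) (P : 'I_n -> V)
    (phi : V -> C) : Prop :=
  forall (t j : nat) (h : (j + (t + t) <= n)%N),
    (0 < t)%N -> ~ repetitively_coloured phi (subpath P h).

(* Lists may be infinite; `I_r #<= A says that A has at least r elements. *)
Definition list_assignment (V C : Type) (r : nat) (L : V -> set C) : Prop :=
  forall v, `I_r #<= L v.

Definition L_colouring (V C : Type) (L : V -> set C) (phi : V -> C) : Prop :=
  forall v, L v (phi v).

(* The possibly infinite set A has at least x elements, x being a real. *)
Definition at_least (R : realType) (T : Type) (x : R) (A : set T) : Prop :=
  exists m : nat, x <= m%:R /\ `I_m #<= A.

(* Main.v *)
Require Import Defs.
From mathcomp Require Import all_boot all_order all_algebra.
From mathcomp Require Import boolp classical_sets functions cardinality reals.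
From mathcomp Require Import zify ring lra.

Set Implicit Arguments.
Unset Strict Implicit.
Unset Printing Implicit Defensive.

Import Order.TTheory GRing.Theory Num.Theory.

Local Open Scope classical_set_scope.
Local Open Scope ring_scope.

(** Let s_n be the number of nonrepetitive colourings of the first n vertices
from lists of size r.  Among the r s_n one-vertex extensions, an extension that
creates a repetition of length 2t is determined by its first n+1-t colours,
which form a nonrepetitive colouring; so r s_n <= s_{n+1} + (s_n + ... + s_0).
As k is a root of X^2 - r X + r, the invariant
(k - 1)(s_0 + ... + s_n) <= k s_n propagates and gives s_{n+1} >= k s_n. *)

(** * Counting square-free words over lists *)

Section SquareFreeWords.
Variables (C : eqType) (l : nat -> seq C).
Local Open Scope nat_scope.

(** The half-length is [t.+1], which rules out the empty square. On a nonempty word too short for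
    such a square the two sides differ in size, so the test fails. *)
Definition square_prefix (t : nat) (w : seq C) : bool :=
  take t.+1 w == take t.+1 (drop t.+1 w).

(* Words are stored in reverse: the head is the colour of the last vertex. *)
Fixpoint sqfree_words (n : nat) : seq (seq C) :=
  if n is m.+1 then
    [seq w <- [seq x :: w | w <- sqfree_words m, x <- l m]
          | ~~ has (square_prefix^~ w) (iota 0 n)]
  else [:: [::]].

Lemma sqfree_wordsS n w : w \in sqfree_words n.+1 ->
  exists x v, [/\ w = x :: v, v \in sqfree_words n, x \in l n &
    forall t, t < n.+1 -> ~~ square_prefix t w].
Proof.
rewrite mem_filter => /andP[/hasPn sq /allpairsP[[v x] /=]].
move=> [vS xl wE]; exists x, v; split=> // t tn.
by apply: sq; rewrite mem_iota.
Qed.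

Lemma size_sqfree_word n w : w \in sqfree_words n -> size w = n.
Proof.
elim: n w => [|n IHn] w; first by rewrite inE => /eqP->.
by move=> /sqfree_wordsS[x [v [-> /IHn vS _ _]]] /=; rewrite vS.
Qed.

Lemma drop_sqfree_word n d w :
  w \in sqfree_words n -> drop d w \in sqfree_words (n - d).
Proof.
elim: n d w => [|n IHn] [|d] w; rewrite ?drop0 ?subn0 //.
  by rewrite inE => /eqP->.
by move=> /sqfree_wordsS[x [v [-> vS _ _]]] /=; rewrite subSS IHn.
Qed.

Lemma nth_sqfree_word x0 n i w :
  w \in sqfree_words n -> i < n -> nth x0 w (n.-1 - i) \in l i.
Proof.
elim: n i w => [//|n IHn] i w /sqfree_wordsS[x [v [-> vS xl _]]].
rewrite ltnS leq_eqVlt => /predU1P[->|lt_in]; first by rewrite subnn.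
have -> : n.+1.-1 - i = (n.-1 - i).+1 by lia.
exact: IHn.
Qed.

(** A square at offset [d] was already tested when its head letter was added. *)
Lemma sqfree_word_no_square n w d t : w \in sqfree_words n ->
  d + t.+1 <= n -> ~~ square_prefix t (drop d w).
Proof.
move=> /(drop_sqfree_word d); case E: (n - d) => [|m]; first by lia.
by move=> /sqfree_wordsS[x [v [_ _ _ sq]]] dtn; apply: sq; lia.
Qed.

Lemma uniq_extensions (s : seq (seq C)) (a : seq C) :
  uniq s -> uniq a -> uniq [seq x :: w | w <- s, x <- a].
Proof.
by move=> us ua; apply: allpairs_uniq => // -[v x] [w y] _ _ /= [-> ->].
Qed.

Lemma uniq_sqfree_words n :
  (forall i, i < n -> uniq (l i)) -> uniq (sqfree_words n).
Proof.
elim: n => [//|n IHn] ul; apply: filter_uniq.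
by apply: uniq_extensions; [apply: IHn => i /leqW/ul|apply: ul].
Qed.

(** The union bound. *)
Lemma count_has_leq (S T : eqType) (Q : S -> T -> bool) (a : seq S)
    (s : seq T) :
  count (fun x => has (Q x) s) a <= \sum_(t <- s) count (Q^~ t) a.
Proof.
elim: s => [|t s IHs]; first by rewrite big_nil; elim: a.
rewrite big_cons (leq_trans _ (leq_add (leqnn _) IHs)) //.
have -> : count (fun x => has (Q x) (t :: s)) a =
  count (predU (Q^~ t) (fun x => has (Q x) s)) a by apply: eq_count.
by rewrite -count_predUI leq_addr.
Qed.

(** On words with a square prefix of half-length [t.+1], [drop t.+1] is injective: the deleted half
    is the start of what remains. It leaves a square-free word of length [n.+1 - t.+1]. *)
Lemma count_square_extensions n t : t <= n ->
  (forall i, i < n.+1 -> uniq (l i)) ->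
  count (square_prefix t) [seq x :: w | w <- sqfree_words n, x <- l n]
    <= size (sqfree_words (n - t)).
Proof.
move=> tn ul; set A := [seq _ | _ <- _, _ <- _].
rewrite -size_filter -(size_map (drop t.+1)); apply: uniq_leq_size.
  rewrite map_inj_in_uniq.
    apply/filter_uniq/uniq_extensions; last exact: ul.
    by apply: uniq_sqfree_words => i /leqW/ul.
  move=> v w; rewrite !mem_filter => /andP[/eqP sqv _] /andP[/eqP sqw _] vw.
  by rewrite -(cat_take_drop t.+1 v) -(cat_take_drop t.+1 w) sqv sqw vw.
move=> z /mapP[w]; rewrite mem_filter => /andP[_ /allpairsP[[v x] /=]].
by move=> [vS _ ->] -> /=; apply: drop_sqfree_word.
Qed.

Lemma leq_size_sqfree_words r n :
  (forall i, i < n.+1 -> uniq (l i)) -> size (l n) = r ->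
  r * size (sqfree_words n) <=
    size (sqfree_words n.+1) + \sum_(0 <= j < n.+1) size (sqfree_words j).
Proof.
(* Reversing the sum pairs half-length [t.+1] with the words of length [n - t]. *)
move=> ul lr; rewrite big_nat_rev /= mulnC -lr.
rewrite -(size_allpairs (fun w x => x :: w)) size_filter.
rewrite -[X in X <= _](count_predC
  (fun w => ~~ has (square_prefix^~ w) (iota 0 n.+1))) leq_add2l.
rewrite (eq_count (a2 := fun w => has (square_prefix^~ w) (iota 0 n.+1)));
  last by move=> w /=; rewrite negbK.
apply: leq_trans
  (@count_has_leq _ _ (fun w => square_prefix^~ w) _ (iota 0 n.+1)) _.
rewrite /index_iota subn0 big_seq [X in _ <= X]big_seq; apply: leq_sum => t.
rewrite mem_iota /= => tn.
by rewrite add0n subSS; apply: count_square_extensions.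
Qed.

End SquareFreeWords.

(** * Growth rate from the recurrence *)

Lemma expr_le_of_recurrence (R : realFieldType) (k r : R) (s : nat -> R)
    (n : nat) :
  1 < k -> k ^+ 2 - r * k + r = 0 -> s 0%N = 1 ->
  (forall i, 0 <= s i) ->
  (forall i, (i < n)%N -> r * s i <= s i.+1 + \sum_(0 <= j < i.+1) s j) ->
  k ^+ n <= s n.
Proof.
move=> k1 kE s0 s_ge0 rec.
have grow i : (i < n)%N ->
    (k - 1) * \sum_(0 <= j < i.+1) s j <= k * s i -> k * s i <= s i.+1.
  (* The factor [k - 1] lets the invariant bound the partial sum by [k * s i]; the quadratic
     equation for [k] then balances the terms exactly. *)
  move=> /rec ri inv; rewrite -(ler_pM2l (_ : 0 < k - 1)); last by lra.
  have := ler_wpM2l (_ : 0 <= k - 1) ri.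
  have -> : (k - 1) * (k * s i) = (k - 1) * (r * s i) - k * s i.
    have kk : k ^+ 2 = r * k - r by lra.
    by rewrite mulrA mulrBl -expr2 kk; ring.
  by rewrite mulrDr => /(_ _); lra.
suff H i : (i <= n)%N -> k ^+ i <= s i /\
    (k - 1) * \sum_(0 <= j < i.+1) s j <= k * s i.
  by have [] := H n (leqnn n).
elim: i => [_|i IHi lt_in]; first by rewrite expr0 big_nat1 s0; split; lra.
have [ki inv] := IHi (ltnW lt_in); have gi := grow i lt_in inv.
split.
  by rewrite exprS (le_trans _ gi)// ler_wpM2l //; lra.
(* The old sum contributes at most [k * s i <= s i.+1], and
   [s i.+1 + (k - 1) * s i.+1 = k * s i.+1]. *)
by rewrite big_nat_recr //= mulrDr; lra.
Qed.

(** Used to select exactly [r] colours from each possibly infinite list. *)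
Lemma card_le_ord_inj (T : Type) (A : set T) (r : nat) : (`I_r #<= A)%card ->
  exists f : 'I_r -> T, injective f /\ forall i, A (f i).
Proof.
move=> /card_leP[g].
pose u (i : 'I_r) := g (SigSub (mem_set (ltn_ord i : `I_r i))).
exists (fun i => \val (u i)); split=> [i j /val_inj|i]; last exact: set_valP.
move=> /(@inj _ _ _ g); rewrite !inE => /(_ I I) /(congr1 \val) /= ij.
exact: val_inj.
Qed.

Lemma quadratic_root_bounds (R : realType) (r : nat) : (4 <= r)%N ->
  let k : R := 2^-1 * (r%:R + Num.sqrt (r%:R ^+ 2 - 4 * r%:R)) in
  [/\ r%:R - 2 <= k, 1 < k & k ^+ 2 - r%:R * k + r%:R = 0].
Proof.
move=> hr k; have r4 : (4 : R) <= r%:R by rewrite ler_nat.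
move: (r%:R : R) r4 @k => x x4.
have D0 : 0 <= x ^+ 2 - 4 * x by nra.
have := sqr_sqrtr D0; have := sqrtr_ge0 (x ^+ 2 - 4 * x).
move: (Num.sqrt _) => d d0 dE /=.
(* Indeed [d ^+ 2 = x * (x - 4)] is at least [(x - 4) ^+ 2]; this yields [x - 2 <= k]. *)
have dx : x - 4 <= d by nra.
by split; [lra|lra|nra].
Qed.

(** * From square-free words to colourings of the path *)

Section PathColourings.
Variables (V C : Type) (n r : nat) (P : 'I_n -> V) (g : V -> 'I_n).
Variables (L : V -> set C) (f : V -> 'I_r -> C).
Hypotheses (r_gt0 : (0 < r)%N) (PK : cancel P g) (gK : cancel g P).
Hypotheses (f_inj : forall v, injective (f v)) (fL : forall v i, L v (f v i)).

(** [{classic C}] supplies the equality test that words need. Indices from [n] on get the empty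
    list. *)
Definition path_list (i : nat) : seq {classic C} :=
  if insub i is Some o then [seq f (P o) j | j <- enum 'I_r] else [::].

(** The index undoes the reversal of words. A colour chosen for [v] serves as default, so [C] need
    not be assumed inhabited. *)
Definition word_colouring (w : seq {classic C}) (v : V) : C :=
  nth (f v (Ordinal r_gt0) : {classic C}) w (n.-1 - g v).

Lemma path_listE (i : 'I_n) : path_list i = [seq f (P i) j | j <- enum 'I_r].
Proof. by rewrite /path_list valK. Qed.

Lemma size_path_list i : (i < n)%N -> size (path_list i) = r.
Proof.
by move=> lt_in; rewrite (path_listE (Ordinal lt_in)) size_map size_enum_ord.
Qed.

Lemma uniq_path_list i : (i < n)%N -> uniq (path_list i).
Proof.
move=> lt_in; rewrite (path_listE (Ordinal lt_in)).
by rewrite map_inj_uniq ?enum_uniq //; apply: f_inj.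
Qed.

Let S := sqfree_words path_list n.

Lemma word_colouring_L w : w \in S -> L_colouring L (word_colouring w).
Proof.
move=> wS v; rewrite /word_colouring.
have := nth_sqfree_word (f v (Ordinal r_gt0) : {classic C}) wS (ltn_ord (g v)).
by rewrite path_listE gK => /mapP[j _ ->]; apply: fL.
Qed.

Lemma word_colouring_path w (i : 'I_n) x0 : w \in S ->
  word_colouring w (P i) = nth x0 w (n.-1 - i).
Proof.
move=> wS; rewrite /word_colouring PK; apply: set_nth_default.
by rewrite (size_sqfree_word wS); have := ltn_ord i; lia.
Qed.

Lemma word_colouring_nonrepetitive w :
  w \in S -> nonrepetitive P (word_colouring w).
Proof.
move=> wS [//|t] j h _ rep; have sw := size_sqfree_word wS.
have lt_jn : (j < n)%N by lia.
pose x0 : {classic C} := f (P (Ordinal lt_jn)) (Ordinal r_gt0).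
(* The number of vertices after the repetitive subpath, hence the offset of the square in the
   reversed word. *)
set d := (n - (j + (t.+1 + t.+1)))%N.
have := @sqfree_word_no_square _ _ _ _ d t wS; rewrite /square_prefix.
move=> /(_ ltac:(lia))/eqP; apply; apply: (@eq_from_nth _ x0).
  by rewrite !size_takel // !size_drop sw /d; lia.
move=> a; rewrite size_take_min leq_min => /andP[lt_at _].
rewrite !nth_take // !nth_drop.
(* Reversal swaps the two halves and sends letter [a] of a block to vertex [t - a] of the matching
   half. *)
have lt_bt : (t - a < t.+1)%N by lia.
have := rep (Ordinal lt_bt); rewrite /subpath !(word_colouring_path _ x0) //=.
have -> : (n.-1 - (j + (t - a)) = d + (t.+1 + a))%N by lia.
by have -> : (n.-1 - (j + (t.+1 + (t - a))) = d + a)%N by lia.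
Qed.

Lemma word_colouring_inj : {in S &, injective word_colouring}.
Proof.
move=> v w vS wS vw; have sv := size_sqfree_word vS.
have sw := size_sqfree_word wS.
(* With [n = 0] there is no vertex to provide a default colour, but both words are empty. *)
case: (posnP n) => [n0|n_gt0].
  by apply/eqP; move/eqP: sv; move/eqP: sw; rewrite n0 !size_eq0 => /eqP-> ->.
pose x0 : {classic C} := f (P (Ordinal n_gt0)) (Ordinal r_gt0).
apply: (@eq_from_nth _ x0) => [|a]; first by rewrite sv sw.
rewrite sv => lt_an; have lt_bn : (n.-1 - a < n)%N by lia.
(* Letter [a] is the colour of the vertex of index [n.-1 - a]. *)
have := congr1 (@^~ (P (Ordinal lt_bn))) vw.
rewrite !(word_colouring_path _ x0) //=.
by have -> : (n.-1 - (n.-1 - a) = a)%N by lia.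
Qed.

Lemma card_nonrepetitive_L_colourings :
  (`I_(size S) #<=
    [set phi : V -> C | L_colouring L phi /\ nonrepetitive P phi])%card.
Proof.
have uS : uniq S by apply: uniq_sqfree_words; apply: uniq_path_list.
have : $|{injfun `I_(size S) >-> [set phi : V -> C |
    L_colouring L phi /\ nonrepetitive P phi]}|.
  apply/injfunPex; exists (fun i => word_colouring (nth [::] S i)).
    move=> i /= iS; have wS := mem_nth [::] iS.
    by split; [apply: word_colouring_L|apply: word_colouring_nonrepetitive].
  move=> i j; rewrite !inE /= => iS jS.
  move=> /word_colouring_inj; rewrite !mem_nth // => /(_ isT isT) /eqP.
  by rewrite nth_uniq // => /eqP.
by move=> [h]; apply: inj_card_le h.
Qed.

End PathColourings.

Theorem theorem25 (R : realType) (r : nat) (hr : (4 <= r)%N) :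
  let k : R := 2^-1 * (r%:R + Num.sqrt (r%:R ^+ 2 - 4 * r%:R)) in
  r%:R - 2 <= k /\
  forall (n : nat) (V C : Type) (P : 'I_n -> V) (L : V -> set C),
    bijective P -> list_assignment r L ->
    at_least (k ^+ n)
      [set phi : V -> C | L_colouring L phi /\ nonrepetitive P phi].
Proof.
move=> k; have [k_ge k1 kE] := quadratic_root_bounds R hr.
split=> // n V C P L [g PK gK] Lr.
have /choice[f fP] v := card_le_ord_inj (Lr v).
have r_gt0 : (0 < r)%N by lia.
exists (size (sqfree_words (path_list P f) n)); split; last first.
  by apply: (card_nonrepetitive_L_colourings r_gt0 PK gK) => v; case: (fP v).
pose s i : R := (size (sqfree_words (path_list P f) i))%:R.
(* The recurrence is required only for [i < n], where [path_list] has [r] distinct colours. *)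
apply: (@expr_le_of_recurrence _ k r%:R s) => // i lt_in.
rewrite /s -natr_sum -natrD -natrM ler_nat; apply: leq_size_sqfree_words.
  move=> j ji; apply: uniq_path_list; last by lia.
  by move=> v; case: (fP v).
exact: size_path_list.
Qed.
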